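(* Let $\mathcal{H}$ be a linear and $r$-uniform hypergraph with $n$ vertices and $m$ edges, where $r\ge 4$ and $m\ge 3$. If $k$ is a positive integer with $k\ge \frac{0.831(m-1)}{\log(m-1)}$ and $L$ is a $k$-assignment of $\mathcal{H}$ with $\alpha(\mathcal{H},L)>0$, then $$P(\mathcal{H},L)-P(\mathcal{H},k)>(m-1)^{-1.796}\bigl(1+1.796\log(m-1)\bigr)k^{n-r}\,\alpha(\mathcal{H},L).$$ Hence $P_l(\mathcal{H},k)=P(\mathcal{H},k)$ holds for every positive integer $k$ with $k\ge \frac{0.831(m-1)}{\log(m-1)}$.
   Context: All hypergraphs $\mathcal{H}$ are finite, with vertex set $V(\mathcal{H})$ and edge set $E(\mathcal{H})$ (a set of subsets of $V(\mathcal{H})$), where $|e|\ge 2$ for every edge $e$ and $e_1\not\subseteq e_2$ for any two distinct edges $e_1,e_2$. $\mathcal{H}$ is $r$-uniform if $|e|=r$ for every edge $e$, and linear if $|e_1\cap e_2|\le 1$ for any two distinct edges $e_1,e_2$. $\mathbb{N}$ is the set of positive integers, $[k]=\{1,\dots,k\}$, and $\log$ is the natural logarithm. For $k\in\mathbb{N}$, a proper $k$-coloring of $\mathcal{H}$ is a map $\theta:V(\mathcal{H})\to[k]$ such that $|\{\theta(v): v\in e\}|\ge 2$ for each edge $e$; $P(\mathcal{H},k)$ is the number of proper $k$-colorings. A $k$-assignment $L$ of $\mathcal{H}$ assigns to each vertex $v$ a set $L(v)\subseteq\mathbb{N}$ with $|L(v)|=k$. An $L$-coloring is a map $\theta:V(\mathcal{H})\to\mathbb{N}$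 with $\theta(v)\in L(v)$ for all $v$ and $|\{\theta(v): v\in e\}|\ge 2$ for each edge $e$; $P(\mathcal{H},L)$ is the number of $L$-colorings. The list-color function $P_l(\mathcal{H},k)$ is the minimum of $P(\mathcal{H},L)$ over all $k$-assignments $L$ of $\mathcal{H}$. For a $k$-assignment $L$ and an edge $e$, $\alpha(e,L):=k-\left|\bigcap_{v\in e}L(v)\right|$, and $\alpha(\mathcal{H},L):=\sum_{e\in E(\mathcal{H})}\alpha(e,L)$. *)

(* Defs.v *)
From mathcomp Require Import all_boot all_order all_algebra.
From mathcomp Require Import finmap.
From mathcomp Require Import all_classical all_reals all_analysis.

Set Implicit Arguments.
Unset Strict Implicit.
Unset Printing Implicit Defensive.

Local Open Scope nat_scope.
Local Open Scope fset_scope.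

Record hypergraph (T : finType) := Hypergraph {
  edges : {set {set T}};
  edges_card : forall e, e \in edges -> 2 <= #|e|;
  edges_antichain : forall e1 e2, e1 \in edges -> e2 \in edges ->
    e1 != e2 -> ~~ (e1 \subset e2)
}.

Section Hypergraph.
Variables (T : finType) (H : hypergraph T).

Definition uniform (r : nat) : Prop := forall e, e \in edges H -> #|e| = r.

Definition linear_hypergraph : Prop :=
  forall e1 e2, e1 \in edges H -> e2 \in edges H ->
    e1 != e2 -> #|e1 :&: e2| <= 1.

Definition proper_coloring (C : choiceType) (theta : T -> C) : bool :=
  [forall e in edges H, 2 <= #|` [fset theta v | v in e]|].

Definition num_colorings (k : nat) : nat :=
  #|[set theta : {ffun T -> 'I_k} | proper_coloring theta]|.

(* Colors are positive integers, hence the exclusion of 0. *)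
Definition assignment (k : nat) (L : T -> {fset nat}) : Prop :=
  forall v, #|` L v| = k /\ 0 \notin L v.

(* A map theta : T -> nat with theta v \in L v for all v is encoded as a
   dependent function valued in the finite types underlying the lists. *)
Definition num_list_colorings (L : T -> {fset nat}) : nat :=
  #|[set theta : {dffun forall v : T, L v} | proper_coloring (fun v => val (theta v))]|.

Definition list_color_value (k p : nat) : bool :=
  `[< exists2 L, assignment k L & p = num_list_colorings L >].

Lemma list_color_value_ex (k : nat) : exists p, list_color_value k p.
Proof.
pose s : {fset nat} := [fset x in iota 1 k].
exists (num_list_colorings (fun=> s)); apply/asboolP; exists (fun=> s) => // v.
split; last by rewrite !inE mem_iota.
by rewrite card_fseq undup_id ?iota_uniq // size_iota.
Qed.

Definition list_color_function (k : nat) : nat :=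
  ex_minn (list_color_value_ex k).

(* There is no full set in {fset nat}, so the intersection is cut out of the
   union; for nonempty e this is the usual intersection. *)
Definition common_colors (L : T -> {fset nat}) (e : {set T}) : {fset nat} :=
  [fset c in \bigcup_(v in e) L v | [forall v in e, c \in L v]].

(* For a k-assignment L and nonempty e the truncated subtraction is exact. *)
Definition alpha_edge (k : nat) (L : T -> {fset nat}) (e : {set T}) : nat :=
  k - #|` common_colors L e|.

Definition alpha (k : nat) (L : T -> {fset nat}) : nat :=
  \sum_(e in edges H) alpha_edge k L e.

End Hypergraph.

(* Main.v *)
(* Edges with deficit alpha(e, L) = 0 carry the same list on all their vertices,
   so relabeling each list bijectively onto [k] preserves the set of maps that
   are proper on these edges. Choosing the bijections so that they send a common
   color c of another edge f to a color d shows that the number p_f of such maps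
   that are constantly c on f does not depend on c, nor on whether L or [k] is
   used. Hence an edge f of positive deficit is monochromatic in
   (k - alpha(f, L)) p_f of these maps for L, and in k p_f for [k]. The union bound
   for L and the Bonferroni inequality for [k] now bound P(H, L) - P(H, k) below by
   the sum of the alpha(f, L) p_f, minus the number of maps with two monochromatic
   edges. Linearity gives p_f >= k^(n-r) - m_0 k^(n-2r+1), where m_0 is the number
   of edges of deficit 0, and at most k^(n-2r+2) maps for a pair. Since r >= 4,
     P(H, L) - P(H, k) >= k^(n-r) alpha(H, L) (1 - (m-1) / (2 k^2)),
   and the hypothesis on k makes the last factor larger than the one claimed. *)
Require Import Defs.
From mathcomp Require Import all_boot all_order all_algebra.
From mathcomp Require Import perm finmap zify.

Set Implicit Arguments.
Unset Strict Implicit.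
Unset Printing Implicit Defensive.

(** * The second Bonferroni inequality *)

Lemma bonferroni2 (X I : finType) (A : {set X}) (J : {set I}) (P : I -> pred X) :
  2 * \sum_(i in J) #|[set x in A | P i x]| <=
  2 * #|[set x in A | [exists i in J, P i x]]| +
  \sum_(i in J) \sum_(j in J | j != i) #|[set x in A | P i x && P j x]|.
Proof.
have cardE (Q : pred X) : #|[set x in A | Q x]| = \sum_(x in A) Q x.
  rewrite -sum1dep_card big_mkcondr /=.
  by apply: eq_bigr => x _; case: (Q x).
rewrite cardE; under eq_bigr do rewrite cardE.
under [X in _ + X]eq_bigr do under eq_bigr do rewrite cardE.
rewrite exchange_big /= [X in _ + X](eq_bigr _ (fun i _ => exchange_big _ _ _ _ _ _)).
rewrite [X in _ + X]exchange_big /= !big_distrr -big_split; apply: leq_sum => x _ /=.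
(* Counted pointwise: an element satisfying t > 0 of the predicates adds 2t on the left and 2 + t(t
   - 1) on the right, and (t - 1)(t - 2) >= 0. Pairs are ordered, hence the factors 2. *)
pose t := \sum_(i in J) P i x.
have pairsE : \sum_(i in J) \sum_(j in J | j != i) (P i x && P j x) = t * t.-1.
  rewrite big_distrl; apply: eq_bigr => i iJ /=.
  case Pi: (P i x) => /=; last by rewrite mul0n big1.
  by rewrite mul1n /t [in RHS](bigD1 i) //= Pi.
rewrite pairsE -/t; case: existsP => [_|noP].
  by case: (t) => [//|[//|[//|s]]] /=; nia.
suff -> : t = 0 by [].
by rewrite /t big1 // => i iJ; case Pi: (P i x) => //; case: noP; exists i; rewrite iJ.
Qed.

(** * Monochromatic edges and maps that are proper on a set of edges *)

Definition monochromatic (T : finType) (X : eqType) (theta : T -> X) (e : {set T}) :=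
  [forall u in e, forall v in e, theta u == theta v].

Lemma monochromaticP (T : finType) (X : eqType) (theta : T -> X) (e : {set T}) :
  reflect {in e &, forall u v, theta u = theta v} (monochromatic theta e).
Proof.
apply: (iffP forall_inP) => [mono u v ue ve|mono u ue].
  by have /forall_inP/(_ v ve)/eqP := mono u ue.
by apply/forall_inP => v ve; apply/eqP/mono.
Qed.

Section Colorings.
Variables T C : finType.
Implicit Types (L : T -> {set C}) (e f : {set T}) (E : {set {set T}}).
Implicit Types (theta : {ffun T -> C}) (c d : C).

Definition constantly theta f c : bool := [forall v in f, theta v == c].

Lemma constantlyP theta f c :
  reflect {in f, forall v, theta v = c} (constantly theta f c).
Proof. by apply: (iffP forall_inP) => h v vf; apply/eqP/h. Qed.

Definition list_functions L : {set {ffun T -> C}} :=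
  [set theta : {ffun T -> C} | [forall v, theta v \in L v]].

Definition good L E : {set {ffun T -> C}} :=
  [set theta in list_functions L | [forall e in E, ~~ monochromatic theta e]].

Definition good_at L E f c : {set {ffun T -> C}} :=
  [set theta in good L E | constantly theta f c].

Definition common L f : {set C} := [set c | [forall v in f, c \in L v]].

Lemma list_functionsP L theta :
  reflect (forall v, theta v \in L v) (theta \in list_functions L).
Proof. by rewrite inE; apply: forallP. Qed.

(** * Relabeling of lists *)

Lemma relabeling (S S' : {set C}) c d : #|S| = #|S'| ->
  exists g : C -> C, [/\ {in S &, injective g},
    {in S, forall x, g x \in S'} & c \in S -> d \in S' -> g c = d].
Proof.
(* [h] matches the lists by position. Composing it with the transposition of [h c] and [d]
   prescribes the image of [c]; this is done only when both colors lie in their lists, so that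
   values stay in [S']. *)
move=> eqSS'; pose h x := nth d (enum S') (index x (enum S)).
have idx x : x \in S -> index x (enum S) < size (enum S').
  by move=> xS; rewrite -cardE -eqSS' cardE index_mem mem_enum.
have hS x : x \in S -> h x \in S'.
  by move=> xS; rewrite -mem_enum mem_nth // idx.
have hinj : {in S &, injective h}.
  move=> x y xS yS /eqP; rewrite nth_uniq ?enum_uniq ?idx // => /eqP eqi.
  by rewrite -[x](@nth_index _ d x (enum S)) ?mem_enum // eqi nth_index ?mem_enum.
have [/andP[cS dS']|no] := boolP ((c \in S) && (d \in S')); last first.
  by exists h; split=> // cS dS'; rewrite cS dS' in no.
exists (fun x => tperm (h c) d (h x)); split=> [x y xS yS /perm_inj|x xS|_ _].
- exact: hinj.
- by case: tpermP => // _; rewrite ?hS.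
- by rewrite tpermL.
Qed.

(* Each list is mapped to the corresponding new list by a bijection that only
   depends on the two lists, so that edges whose vertices all carry the same
   list keep their monochromatic patterns. *)
Lemma leq_good_at L L' E f c d :
  (forall v, #|L v| = #|L' v|) ->
  {in E, forall e, {in e &, forall u v, L u = L v}} ->
  {in E, forall e, {in e &, forall u v, L' u = L' v}} ->
  {in f, forall v, c \in L v} -> {in f, forall v, d \in L' v} ->
  #|good_at L E f c| <= #|good_at L' E f d|.
Proof.
move=> eqLL' constL constL' cL dL'.
have /fin_all_exists[g gP] : forall SS : {set C} * {set C}, exists g : C -> C,
    #|SS.1| = #|SS.2| -> [/\ {in SS.1 &, injective g},
    {in SS.1, forall x, g x \in SS.2} & c \in SS.1 -> d \in SS.2 -> g c = d].
  move=> [S S'] /=; have [/(relabeling c d)[g gP]|ne] := eqVneq #|S| #|S'|.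
    by exists g.
  by exists id => eqS; rewrite eqS eqxx in ne.
pose G theta : {ffun T -> C} := [ffun v => g (L v, L' v) (theta v)].
have {}gP v := gP (L v, L' v) (eqLL' v).
have Ginj : {in list_functions L &, injective G}.
  move=> t1 t2 /list_functionsP t1L /list_functionsP t2L /ffunP eqG.
  apply/ffunP => v; have := eqG v; rewrite !ffunE.
  by case: (gP v) => /= + _ _; apply.
have sub : good_at L E f c \subset list_functions L.
  by apply/subsetP => t; rewrite !inE -!andbA => /and3P[].
rewrite -(card_in_imset (f := G)); last first.
  by move=> t1 t2 /(subsetP sub) t1L /(subsetP sub) t2L; apply: Ginj.
apply/subset_leq_card/subsetP => _ /imsetP[t + ->].
rewrite !inE -!andbA => /and3P[/forallP tL tE /constantlyP tf].
apply/and3P; split.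
- by apply/forallP => v; rewrite ffunE; case: (gP v) => /= _ + _; apply.
- apply/forall_inP => e eE; apply: contraNN (forall_inP tE e eE).
  move/monochromaticP => mono; apply/monochromaticP => u v ue ve.
  have := mono u v ue ve; rewrite !ffunE -(constL _ eE u v) // -(constL' _ eE u v) //.
  by case: (gP u) => /= + _ _; apply => //; rewrite (constL _ eE u v).
- apply/constantlyP => v vf; rewrite ffunE tf //.
  by case: (gP v) => /= _ _; apply; [apply: cL | apply: dL'].
Qed.

(** * Counting maps with monochromatic or determined parts *)

Lemma card_good_at_set0 L E c : good_at L E set0 c = good L E.
Proof.
apply/setP => t; rewrite inE andb_idr // => _.
by apply/constantlyP => v; rewrite inE.
Qed.

(** The maps are sorted by their color at one vertex of [f]; being shared by all of [f], this color
    lies in [common L f]. *)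
Lemma card_monochromatic_good L E f p : f != set0 ->
  {in common L f, forall c, #|good_at L E f c| = p} ->
  #|[set theta in good L E | monochromatic theta f]| = #|common L f| * p.
Proof.
case/set0Pn => v0 v0f cardp.
rewrite -sum1_card (partition_big (fun t : {ffun T -> C} => t v0) (mem (common L f))) /=.
  rewrite -sum_nat_const; apply: eq_bigr => c cf.
  rewrite sum1dep_card -(cardp c cf); apply: eq_card => t.
  rewrite !inE -!andbA; do 2 congr (_ && _).
  apply/andP/constantlyP => [[/monochromaticP mono /eqP <-] v vf|tf].
    exact: mono.
  by split; [apply/monochromaticP => u v uf vf; rewrite !tf | rewrite tf].
move=> t; rewrite !inE -!andbA => /and3P[/forallP tL _ /monochromaticP mono].
by apply/forall_inP => v vf; rewrite (mono v0 v).
Qed.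

(** With [E1] the edges of positive deficit, this reduces the comparison of proper colorings to that
    of maps with a monochromatic edge in [E1]. *)
Lemma card_good_split L E E1 : E1 \subset E ->
  #|good L (E :\: E1)| = #|good L E| +
    #|[set theta in good L (E :\: E1) | [exists f in E1, monochromatic theta f]]|.
Proof.
move=> sE1; set B := [set _ in _ | _].
rewrite -(cardsID B) addnC; congr (_ + _); apply: eq_card => t; rewrite !inE; last first.
  by rewrite [LHS]andb_idl // => /andP[/andP[-> ->]].
have [tL|] //= := boolP [forall v, t v \in L v]; rewrite negb_and.
apply/andP/forall_inP => [[+ /forall_inP t0] e eE|tE].
  rewrite /=; have [eE1|eE1] := boolP (e \in E1); last first.
    by move=> _; apply: t0; rewrite inE eE1.
  case/orP => [/negP[]|/exists_inPn/(_ e eE1)//].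
  by apply/forall_inP.
have t0 : [forall e in E :\: E1, ~~ monochromatic t e].
  by apply/forall_inP => e /setDP[eE _]; apply: tE.
split=> //; rewrite t0 /=; apply/exists_inPn => e /(subsetP sE1); exact: tE.
Qed.

(** Overwriting the values on [D] by the filler [d] is injective on [A]. *)
Lemma leq_card_determined (K : {set C}) d (D : {set T}) (A : {set {ffun T -> C}}) :
  A \subset list_functions (fun=> K) ->
  {in A &, forall t t' : {ffun T -> C}, (forall v, v \notin D -> t v = t' v) ->
    {in D, forall v, t v = t' v}} ->
  #|A| <= #|K| ^ #|~: D|.
Proof.
move=> AK det; rewrite -(card_pffun_on d (mem (~: D)) (mem K)).
pose G (t : {ffun T -> C}) := [ffun v => if v \in D then d else t v].
rewrite -(card_in_imset (f := G)).
  apply/subset_leq_card/subsetP => _ /imsetP[t tA ->].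
  apply/pffun_onP; split=> [|x /imageP[v vD ->]].
    by apply/supportP => v; rewrite inE negbK ffunE => ->.
  move: vD; rewrite !inE => vD; rewrite ffunE (negbTE vD).
  by have /list_functionsP := subsetP AK _ tA; apply.
move=> t t' tA t'A /ffunP eqG.
have out v : v \notin D -> t v = t' v.
  by move=> vD; have := eqG v; rewrite !ffunE (negbTE vD).
apply/ffunP => v; have [vD|/out//] := boolP (v \in D).
exact: det.
Qed.

Lemma card_constantly (K : {set C}) d f : d \in K ->
  #|[set theta in list_functions (fun=> K) | constantly theta f d]| = #|K| ^ #|~: f|.
Proof.
(* With [d] itself as default value, the maps supported off [f] are those equal to [d] on [f]. *)
move=> dK; rewrite -(card_pffun_on d (mem (~: f)) (mem K)).
apply: eq_card => t; rewrite !inE; apply/andP/pffun_onP.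
  case=> /forallP tK /constantlyP tf; split=> [|x /imageP[v _ ->] //].
  by apply/supportP => v; rewrite inE negbK => /tf.
case=> /supportP tf tK; have {}tf v : v \in f -> t v = d.
  by move=> vf; apply: tf; rewrite inE vf.
split; last exact/constantlyP.
apply/forallP => v; have [/tf->//|vf] := boolP (v \in f).
by apply/tK/imageP; exists v; rewrite ?inE.
Qed.

(** The intersection lies in each [L v] and is at least as large, so it equals each of them. This is
    how deficit zero is exploited. *)
Lemma common_full L k f : (forall v, #|L v| = k) -> k <= #|common L f| ->
  {in f &, forall u v, L u = L v}.
Proof.
move=> cardL full; suff comm v : v \in f -> common L f = L v.
  by move=> u v /comm <- /comm <-.
move=> vf; apply/eqP; rewrite eqEcard cardL full andbT.
by apply/subsetP => c; rewrite inE => /forall_inP; apply.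
Qed.

Lemma common_const (K : {set C}) f : f != set0 -> common (fun=> K) f = K.
Proof.
case/set0Pn => v vf; apply/setP => c; rewrite inE.
by apply/forall_inP/idP => [/(_ v vf)|].
Qed.

Lemma card_bigcup_leq (I X : finType) (J : {set I}) (F : I -> {set X}) :
  #|\bigcup_(i in J) F i| <= \sum_(i in J) #|F i|.
Proof.
elim/big_rec2: _ => [|i m A _ leAm]; first by rewrite cards0.
by apply: leq_trans (leq_card_setU _ _) _; rewrite leq_add2l.
Qed.

(** * Linear uniform hypergraphs: maps with prescribed monochromatic edges *)

Section LinearUniform.
Variables (r : nat) (E : {set {set T}}).
Hypothesis r_gt1 : 1 < r.
Hypothesis uniformE : {in E, forall e, #|e| = r}.
Hypothesis linearE : {in E &, forall e f, e != f -> #|e :&: f| <= 1}.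

Lemma edge_neq0 e : e \in E -> e != set0.
Proof. by move=> eE; rewrite -card_gt0 uniformE // (ltnW r_gt1). Qed.

(** If the edges meet, both pivots are the common vertex; otherwise any vertices do. The color of a
    monochromatic edge can be read off at its pivot, and neither pivot lies in the part removed from
    the other edge. *)
Lemma linear_pivots e f : e \in E -> f \in E -> e != f ->
  exists u w, [/\ u \in e, w \in f, [disjoint e :\ u & f] & [disjoint e & f :\ w]].
Proof.
move=> eE fE ne; have := linearE eE fE ne; rewrite leq_eqVlt ltnS leqn0.
case/orP => [/cards1P[x /setP ef]|].
  have [xe xf] : x \in e /\ x \in f.
    by apply/andP; have := ef x; rewrite !inE eqxx.
  exists x, x; split=> //; rewrite disjoint_subset; apply/subsetP => v /[!inE].
    by case/andP => vx ve; apply: contraNN vx => vf; rewrite -in_set1 -ef inE ve.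
  move=> ve; rewrite negb_and negbK orbC; case vf: (v \in f) => //=.
  by rewrite -in_set1 -ef inE ve.
rewrite cards_eq0 setI_eq0 => dis.
have /set0Pn[u ue] := edge_neq0 eE; have /set0Pn[w wf] := edge_neq0 fE.
exists u, w; split=> //; first exact: disjointWl (subD1set _ _) dis.
exact: disjointWr (subD1set _ _) dis.
Qed.

Variable K : {set C}.
Local Notation LK := (fun=> K).

(** The colors off the 2(r - 1) non-pivot vertices of the two edges determine the map. *)
Lemma card_mono_pair e f d : e \in E -> f \in E -> e != f -> d \in K ->
  #|[set t in list_functions LK | monochromatic t e && monochromatic t f]|
    <= #|K| ^ (#|T| - (r.-1 + r.-1)).
Proof.
move=> eE fE ne dK; have [u [w [ue wf dis1 dis2]]] := linear_pivots eE fE ne.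
have -> : #|T| - (r.-1 + r.-1) = #|~: (e :\ u :|: f :\ w)|.
  rewrite cardsCs setCK cardsU; have /eqP-> : (e :\ u) :&: (f :\ w) == set0.
    by rewrite setI_eq0; apply: disjointWl dis2; apply: subD1set.
  have := cardsD1 u e; have := cardsD1 w f; rewrite ue wf (uniformE eE) (uniformE fE) cards0 subn0.
  lia.
apply: (leq_card_determined d).
  by apply/subsetP => t; rewrite !inE => /and3P[].
move=> t t'; rewrite !inE.
move=> /and3P[_ /monochromaticP te /monochromaticP tf].
move=> /and3P[_ /monochromaticP t'e /monochromaticP t'f] out v.
have uout : u \notin e :\ u :|: f :\ w.
  by rewrite inE negb_or !inE eqxx /= -in_setD1 (disjointFr dis2 ue).
have wout : w \notin e :\ u :|: f :\ w.
  by rewrite inE negb_or [w \in f :\ w]inE !inE eqxx andbT -in_setD1 (disjointFl dis1 wf).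
rewrite !inE => /orP[/andP[_ ve]|/andP[_ vf]].
  by rewrite (te v u) // (t'e v u) // out.
by rewrite (tf v w) // (t'f v w) // out.
Qed.

Lemma card_constantly_mono e f d : e \in E -> f \in E -> e != f -> d \in K ->
  #|[set t in list_functions LK | constantly t e d && monochromatic t f]|
    <= #|K| ^ (#|T| - (r + r.-1)).
Proof.
move=> eE fE ne dK; have [u [w [ue wf dis1 dis2]]] := linear_pivots eE fE ne.
have -> : #|T| - (r + r.-1) = #|~: (e :|: f :\ w)|.
  rewrite cardsCs setCK cardsU; have /eqP-> : e :&: (f :\ w) == set0.
    by rewrite setI_eq0.
  have := cardsD1 w f; rewrite wf (uniformE fE) (uniformE eE) cards0 subn0.
  lia.
apply: (leq_card_determined d).
  by apply/subsetP => t; rewrite !inE => /and3P[].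
move=> t t'; rewrite !inE.
move=> /and3P[_ /constantlyP te /monochromaticP tf].
move=> /and3P[_ /constantlyP t'e /monochromaticP t'f] out v.
(* The pivot of [f] either lies in [e], where the color is [d], or is outside the erased set. *)
have eqw : t w = t' w.
  have [we|we] := boolP (w \in e); first by rewrite te // t'e.
  by apply: out; rewrite !inE eqxx orbF.
rewrite !inE => /orP[ve|/andP[_ vf]]; first by rewrite te // t'e.
by rewrite (tf v w) // (t'f v w).
Qed.

(** From all maps constantly [d] on [f], those with a monochromatic edge in [E0] are removed by a
    union bound. *)
Lemma card_good_at_lower (E0 : {set {set T}}) f d :
  E0 \subset E -> f \in E -> f \notin E0 -> d \in K ->
  #|K| ^ (#|T| - r) <=
    #|good_at LK E0 f d| + #|E0| * #|K| ^ (#|T| - (r + r.-1)).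
Proof.
move=> sE0 fE fE0 dK.
have <- : #|~: f| = #|T| - r by rewrite cardsCs setCK uniformE.
rewrite -(card_constantly f dK).
pose B e := [set t in list_functions LK | constantly t f d && monochromatic t e].
apply: (@leq_trans #|good_at LK E0 f d :|: \bigcup_(e in E0) B e|).
  apply/subset_leq_card/subsetP => t /[!inE] /andP[tK tf]; rewrite tK tf andbT /=.
  have [//|/forall_inPn[e eE0 /negPn mono]] := boolP [forall e in E0, ~~ monochromatic t e].
  by apply/bigcupP; exists e; rewrite // !inE tK tf.
apply: leq_trans (leq_card_setU _ _) _; rewrite leq_add2l.
apply: leq_trans (card_bigcup_leq _ _) _; rewrite -sum_nat_const.
apply: leq_sum => e eE0; apply: card_constantly_mono => //.
  exact: (subsetP sE0).
by apply: contraNneq fE0 => ->.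
Qed.

(** * Comparison of an assignment with the constant list [K] *)

Variables (L : T -> {set C}).
Hypothesis cardL : forall v, #|L v| = #|K|.

Definition deficit f := #|K| - #|common L f|.
Definition unbalanced := [set f in E | 0 < deficit f].
Local Notation E1 := unbalanced.
Local Notation E0 := (E :\: unbalanced).

Lemma balancedP : {in E0, forall e, {in e &, forall u v, L u = L v}}.
Proof.
move=> e /setDP[eE]; rewrite inE eE /= -leqNgt leqn0 subn_eq0.
exact: common_full.
Qed.

(** The common value is p_f; [L'] is taken to be both [L] and the constant list. *)
Lemma card_good_at_balanced L' f c d : (forall v, #|L' v| = #|K|) ->
  {in E0, forall e, {in e &, forall u v, L' u = L' v}} ->
  c \in common L' f -> d \in K -> #|good_at L' E0 f c| = #|good_at LK E0 f d|.
Proof.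
move=> cardL' constL' /[!inE] /forall_inP cf dK.
by apply/eqP; rewrite eqn_leq !leq_good_at.
Qed.

Lemma good_balanced : 0 < #|K| -> #|good L E0| = #|good LK E0|.
Proof.
(* The empty set imposes no color, so all good maps are a case of [good_at]; [d] is arbitrary. *)
case/card_gt0P => d dK; rewrite -(card_good_at_set0 _ _ d) -(card_good_at_set0 LK _ d).
apply: card_good_at_balanced => //; first exact: balancedP.
by rewrite inE; apply/forall_inP => v; rewrite inE.
Qed.

(** Settles the assignments with alpha equal to 0, which the strict inequality does not cover. *)
Lemma good_eq_of_no_deficit : 0 < #|K| -> \sum_(f in E) deficit f = 0 ->
  #|good L E| = #|good LK E|.
Proof.
move=> K0 def0; have := good_balanced K0; suff -> : E1 = set0 by rewrite setD0.
apply/setP => f; rewrite !inE lt0n; case fE: (f \in E) => //=.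
by move/eqP: def0; rewrite sum_nat_eq0 => /forall_inP/(_ f fE) ->.
Qed.

Lemma deficit_inequality d : d \in K ->
  2 * #|good LK E| + 2 * \sum_(f in E1) deficit f * #|good_at LK E0 f d| <=
  2 * #|good L E| + #|E1| * #|E1|.-1 * #|K| ^ (#|T| - (r.-1 + r.-1)).
Proof.
move=> dK; have K0 : 0 < #|K| by apply/card_gt0P; exists d.
have sE1 : E1 \subset E by apply/subsetP => f /[!inE] /andP[].
pose p f := #|good_at LK E0 f d|.
have bound L' : (forall v, #|L' v| = #|K|) ->
    {in E0, forall e, {in e &, forall u v, L' u = L' v}} ->
    {in E1, forall f, #|[set t in good L' E0 | monochromatic t f]| = #|common L' f| * p f}.
  move=> cardL' constL' f fE1; apply: card_monochromatic_good.
    exact/edge_neq0/(subsetP sE1).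
  by move=> c cf; apply: card_good_at_balanced.
have unionL : #|[set t in good L E0 | [exists f in E1, monochromatic t f]]|
    <= \sum_(f in E1) #|common L f| * p f.
  rewrite -(eq_bigr _ (bound L cardL balancedP)).
  apply: leq_trans (card_bigcup_leq _ _); apply/subset_leq_card/subsetP => t.
  rewrite inE => /andP[tg /exists_inP[f fE1 tf]].
  by apply/bigcupP; exists f => //; rewrite inE tg.
have /= := bonferroni2 (good LK E0) E1 (fun f t => monochromatic t f).
(* Since |K| is the deficit of [f] plus |[common L f]|, the second sum will cancel against the union
   bound for [L]. *)
have -> : \sum_(f in E1) #|[set t in good LK E0 | monochromatic t f]| =
    \sum_(f in E1) deficit f * p f + \sum_(f in E1) #|common L f| * p f.
  rewrite -big_split; apply: eq_bigr => f fE1 /=.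
  rewrite (bound LK) // common_const; last exact/edge_neq0/(subsetP sE1).
  rewrite -mulnDl /deficit subnK //.
  have /set0Pn[v vf] := edge_neq0 (subsetP sE1 f fE1).
  rewrite -(cardL v); apply/subset_leq_card/subsetP => c /[!inE] /forall_inP.
  exact.
have pairs : \sum_(f in E1) \sum_(g in E1 | g != f)
    #|[set t in good LK E0 | monochromatic t f && monochromatic t g]| <=
    #|E1| * #|E1|.-1 * #|K| ^ (#|T| - (r.-1 + r.-1)).
  rewrite -mulnA -sum_nat_const; apply: leq_sum => f fE1.
  have -> : #|E1|.-1 = #|E1 :\ f| by rewrite (cardsD1 f E1) fE1.
  rewrite -sum_nat_const.
  rewrite [X in _ <= X](eq_bigl (fun g => (g \in E1) && (g != f))); last first.
    by move=> g; rewrite in_setD1 andbC.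
  apply: leq_sum => g /andP[gE1]; rewrite eq_sym => gf.
  apply: leq_trans (card_mono_pair (subsetP sE1 _ fE1) (subsetP sE1 _ gE1) gf dK).
  apply/subset_leq_card/subsetP => t; rewrite !in_set -!andbA.
  by case/and4P => -> _ -> ->.
have := card_good_split L sE1; have := card_good_split LK sE1.
have := good_balanced K0.
rewrite -[X in 2 * #|good LK E| + 2 * X]/(\sum_(f in E1) deficit f * p f).
move: unionL pairs; set pairs := \sum_(f in E1) \sum_(g in _ | _) _.
set bad := #|[set t in good LK E0 | _]|; set badL := #|[set t in good L E0 | _]|.
set common_sum := \sum_(f in E1) #|_| * _; set deficit_sum := \sum_(f in E1) _.
set bound_pairs := _ * _ ^ _.
move: bad badL pairs common_sum deficit_sum bound_pairs => bad badL pairs cs ds bp.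
move: #|good L E0| #|good LK E0| #|good L E| #|good LK E| => a b a1 b1.
lia.
Qed.

(** Makes the truncated exponents exact, as two edges cover at least 2r - 1 vertices. *)
Lemma card_two_edges : 1 < #|E| -> r + r.-1 <= #|T|.
Proof.
case/card_gt1P => e [f [eE fE ne]]; apply: leq_trans (max_card (mem (e :|: f))).
rewrite cardsU (uniformE eE) (uniformE fE); have := linearE eE fE ne; lia.
Qed.

(** The bound with factor 1 - (m - 1) / (2 k^2), multiplied by 2 k^2 to stay within the naturals. *)
Lemma deficit_lower_bound : 4 <= r -> 1 < #|E| -> 1 < #|K| ->
  0 < \sum_(f in E) deficit f ->
  2 * #|K| ^ 2 * #|good LK E| +
    #|K| ^ (#|T| - r) * (\sum_(f in E) deficit f) * (2 * #|K| ^ 2) <=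
  2 * #|K| ^ 2 * #|good L E| +
    #|K| ^ (#|T| - r) * (\sum_(f in E) deficit f) * #|E|.-1.
Proof.
move=> r4 E2 K2; have /card_gt0P[d dK] := ltnW K2.
have nr := card_two_edges E2; set k := #|K| in K2 *.
pose q := k ^ (#|T| - (r + r.-1)).
have NE : k ^ (#|T| - r) = k ^ r.-1 * q.
  by rewrite -expnD; congr (_ ^ _); lia.
have pairE : k ^ (#|T| - (r.-1 + r.-1)) = k * q.
  by rewrite -expnS; congr (_ ^ _); lia.
have -> : \sum_(f in E) deficit f = \sum_(f in E1) deficit f.
  rewrite (big_setID E1) /= (setIidPr _).
    rewrite [X in _ + X]big1 ?addn0 // => f /setDP[fE].
    by rewrite inE fE /= lt0n negbK => /eqP.
  by apply/subsetP => f /[!inE] /andP[].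
set a := \sum_(f in E1) deficit f => a0.
have lower : a * k ^ (#|T| - r) <=
    \sum_(f in E1) deficit f * #|good_at LK E0 f d| + a * (#|E0| * q).
  rewrite !big_distrl -big_split; apply: leq_sum => f fE1 /=.
  rewrite -mulnDr leq_mul2l card_good_at_lower ?orbT ?subsetDl //.
    by move: fE1; rewrite inE => /andP[].
  by rewrite inE fE1.
(* Each unbalanced edge has deficit at least 1, which lets [a] replace one factor of
   [m1 * m1.-1]. *)
have m1a : #|E1| <= a.
  by rewrite -sum1_card; apply: leq_sum => f; rewrite inE => /andP[].
have m1_gt0 : 0 < #|E1|.
  by rewrite card_gt0; apply: contraTneq a0 => E10; rewrite /a E10 big_set0.
have mE : #|E1| + #|E0| = #|E|.
  rewrite -(cardsID E1 E) (setIidPr _) //.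
  by apply/subsetP => f /[!inE] /andP[].
have := deficit_inequality dK; rewrite -/k pairE.
(* Here r >= 4 enters. *)
have k3N : k ^ 3 * q <= k ^ (#|T| - r).
  by rewrite NE leq_mul2r leq_exp2l ?orbT //; lia.
move: lower mE; set N := k ^ _; rewrite -/N in k3N *.
move: (\sum_(f in E1) deficit f * _) => s.
move: #|good LK E| #|good L E| m1a m1_gt0 => PK PL.
move: #|E1| #|E0| #|E| => m1 m0 m m1a m1_gt0 lower mE ineq.
have le1 : 2 * k ^ 2 * q <= N.
  by apply: leq_trans k3N; rewrite leq_mul2r expnS leq_mul2r K2 !orbT.
have le2 : 2 * (a * N) + 2 * PK <= 2 * PL + 2 * (a * (m0 * q)) + a * m1.-1 * (k * q).
  have : m1 * m1.-1 * (k * q) <= a * m1.-1 * (k * q) by rewrite !leq_mul2r m1a !orbT.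
  lia.
(* Some edge is unbalanced, so m - 1 splits into the balanced edges and the other unbalanced ones;
   after scaling by k^2, each of them costs at most [a * N]. *)
have -> : m.-1 = m0 + m1.-1 by lia.
have le3 : k ^ 2 * (a * (m0 * q)) * 2 <= a * m0 * N.
  by rewrite (_ : _ * 2 = a * m0 * (2 * k ^ 2 * q)) ?leq_mul2l ?le1 ?orbT //; lia.
have le4 : k ^ 2 * (a * m1.-1 * (k * q)) <= a * m1.-1 * N.
  by rewrite (_ : k ^ 2 * _ = a * m1.-1 * (k ^ 3 * q)) ?leq_mul2l ?k3N ?orbT //; lia.
have := leq_mul (leqnn (k ^ 2)) le2.
move: le3 le4; rewrite !mulnDr !mulnDl. lia.
Qed.

End LinearUniform.
End Colorings.

(** * Transfer from lists of naturals to one finite color type *)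

Section Transfer.
Local Open Scope fset_scope.
Local Open Scope nat_scope.
Variable T : finType.

Lemma card_dffun_image (C : finType) (D : T -> finType) (f : forall v, D v -> C)
    (L : T -> {set C}) (P : pred {dffun forall v, D v}) (Q : pred {ffun T -> C}) :
  (forall v, injective (f v)) ->
  (forall v c, reflect (exists x, f v x = c) (c \in L v)) ->
  (forall t, P t = Q [ffun v => f v (t v)]) ->
  #|[set t | P t]| = #|[set t in list_functions L | Q t]|.
Proof.
move=> finj fP PQ; pose G (t : {dffun forall v, D v}) := [ffun v => f v (t v)].
have Ginj : injective G.
  move=> t t' /ffunP eqG; apply/ffunP => v; apply: (finj v).
  by have := eqG v; rewrite !ffunE.
rewrite -(card_imset _ Ginj); apply: eq_card => s; rewrite inE.
apply/imsetP/andP => [[t + ->]|[/list_functionsP sL Qs]].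
  rewrite inE PQ => Qt; split=> //; apply/list_functionsP => v.
  by rewrite ffunE; apply/fP; exists (t v).
have /fin_all_exists[t tP] : forall v, exists x, f v x = s v by move=> v; apply/fP.
have sE : s = G (finfun t) by apply/ffunP => v; rewrite !ffunE.
by exists (finfun t); rewrite // inE PQ -/(G _) -sE.
Qed.

Variable H : hypergraph T.

Lemma hyperedge_neq0 e : e \in edges H -> e != set0.
Proof. by move/edges_card; rewrite -card_gt0; apply: ltnW. Qed.

Lemma proper_coloringE (X : choiceType) (theta : T -> X) :
  proper_coloring H theta = [forall e in edges H, ~~ monochromatic theta e].
Proof.
apply: eq_forallb_in => e eH; rewrite ltnNge; congr (~~ _).
have /set0Pn[w we] := hyperedge_neq0 eH.
have wi : theta w \in [fset theta v | v in e] by apply/imfsetP; exists w.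
apply/idP/monochromaticP => [le1 u v ue ve|mono].
  have /cardfs1P[c cE] : #|` [fset theta v | v in e]| == 1.
    by rewrite eqn_leq le1 cardfs_gt0; apply/fset0Pn; exists (theta w).
  have im x : x \in e -> theta x = c.
    by move=> xe; apply/fset1P; rewrite -cE; apply/imfsetP; exists x.
  by rewrite !im.
rewrite (_ : [fset _ | _ in _] = [fset theta w]) ?cardfs1 //.
apply/fsetP => c; rewrite inE; apply/imfsetP/eqP => [[v /= ve ->]|->].
  exact: mono.
by exists w.
Qed.

Lemma card_ord_fset N (A : {fset nat}) : {in A, forall c, c < N} ->
  #|[set c : 'I_N | val c \in A]| = #|` A|.
Proof.
move=> ltN; rewrite cardE -(size_map val); apply/perm_size/uniq_perm.
- by rewrite map_inj_uniq ?enum_uniq //; apply: val_inj.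
- exact: fset_uniq.
- move=> c; apply/mapP/idP => [[x + ->]|cA]; first by rewrite mem_enum inE.
  by exists (Ordinal (ltN c cA)); rewrite // mem_enum inE.
Qed.

Variables (k : nat) (L : T -> {fset nat}).
Hypothesis cardL : forall v, #|` L v| = k.

(** A crude strict upper bound on all colors in use, which makes the color type finite. *)
Definition color_bound := k + \sum_v \sum_(c <- L v) c.+1.
Local Notation C := 'I_color_bound.
Definition ord_list v : {set C} := [set c : C | val c \in L v].
Definition initial_colors : {set C} := [set c : C | val c < k].

Lemma color_lt_bound v c : c \in L v -> c < color_bound.
Proof.
move=> cL; apply: leq_trans (leq_addl _ _).
rewrite (bigD1 v) //=; apply: leq_trans (leq_addr _ _).
by rewrite (big_rem c) //= leq_addr.
Qed.

Lemma card_ord_list v : #|ord_list v| = k.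
Proof. by rewrite card_ord_fset // => c; apply: color_lt_bound. Qed.

Lemma card_initial_colors : #|initial_colors| = k.
Proof.
have le_k : k <= color_bound by apply: leq_addr.
have winj : injective (widen_ord le_k) by move=> i j /(congr1 val) /= /val_inj.
rewrite -[RHS]card_ord -(card_imset _ winj).
apply: eq_card => c; rewrite inE; apply/idP/imsetP => [ck|[i _ ->]]; last by rewrite /= ltn_ord.
by exists (Ordinal ck) => //; apply: val_inj.
Qed.

Lemma num_list_coloringsE :
  num_list_colorings H L = #|good ord_list (edges H)|.
Proof.
apply: (card_dffun_image (f := fun v (x : L v) => Ordinal (color_lt_bound (valP x)))).
- by move=> v x y /(congr1 val) /= /val_inj.
- move=> v c; rewrite inE; apply: (iffP idP) => [cL|[x <-]].
    by exists [` cL]; apply: val_inj.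
  exact: fsvalP x.
- move=> t; rewrite proper_coloringE; apply: eq_forallb_in => e _; congr (~~ _).
  by apply: eq_forallb_in => u _; apply: eq_forallb_in => v _; rewrite !ffunE.
Qed.

Lemma num_coloringsE :
  num_colorings H k = #|good (fun=> initial_colors) (edges H)|.
Proof.
have le_k : k <= color_bound by apply: leq_addr.
apply: (card_dffun_image (D := fun=> 'I_k) (f := fun=> widen_ord le_k)).
- by move=> v i j /(congr1 val) /= /val_inj.
- move=> v c; rewrite inE; apply: (iffP idP) => [ck|[i <-]]; last by rewrite /= ltn_ord.
  by exists (Ordinal ck); apply: val_inj.
- move=> t; rewrite proper_coloringE; apply: eq_forallb_in => e _; congr (~~ _).
  by apply: eq_forallb_in => u _; apply: eq_forallb_in => v _; rewrite !ffunE.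
Qed.

Lemma alphaE :
  alpha H k L = \sum_(e in edges H) deficit initial_colors ord_list e.
Proof.
apply: eq_bigr => e eH; rewrite /deficit card_initial_colors; congr (_ - _).
have /set0Pn[w we] := hyperedge_neq0 eH.
have mem c : (c \in common_colors L e) = [forall v in e, c \in L v].
  rewrite !inE andb_idl // => /forall_inP h.
  by apply/bigfcupP; exists w; rewrite ?h // mem_index_enum.
rewrite -(@card_ord_fset color_bound) => [|c].
  apply: eq_card => c; rewrite [LHS]in_set mem [RHS]in_set.
  by apply: eq_forallb_in => v _; rewrite inE.
by rewrite mem => /forall_inP/(_ w we)/color_lt_bound.
Qed.

End Transfer.

(** Lets a constant assignment bound the list-color function from above. *)
Lemma alpha_const (T : finType) (H : hypergraph T) k (s : {fset nat}) :
  #|` s| = k -> alpha H k (fun=> s) = 0.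
Proof.
move=> sk; rewrite (@alphaE _ H k) // big1 // => e /hyperedge_neq0 e0.
have /set0Pn[w _] := e0.
rewrite /deficit (common_const (ord_list k (fun=> s) w) e0).
by rewrite card_initial_colors card_ord_list ?subnn.
Qed.

(* Only imported here since classical_sets shadows many names of finset. *)
From mathcomp Require Import all_classical all_reals all_analysis.
From mathcomp Require Import lra.

Import Order.TTheory GRing.Theory Num.Theory.
Local Open Scope ring_scope.

(** * Real estimates for the exponential and the logarithm *)

Section Estimates.
Variable R : realType.
Implicit Types x y l : R.

Lemma ler_nat_div (p q u v : nat) : (0 < q)%N -> (0 < v)%N ->
  (p * v <= u * q)%N -> p%:R / q%:R <= u%:R / v%:R :> R.
Proof.
move=> q0 v0 h; rewrite ler_pdivrMr ?ltr0n // mulrAC ler_pdivlMr ?ltr0n //.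
by rewrite -!natrM ler_nat.
Qed.

(** The terms of the series are nonnegative, so its partial sums stay below the limit. *)
Lemma expR_ge_taylor4 x : 0 <= x ->
  1 + x + x ^+ 2 / 2 + x ^+ 3 / 6 + x ^+ 4 / 24 <= expR x.
Proof.
move=> x0; have := @nondecreasing_cvgn_le _ (series (exp_coeff x)).
move=> /(_ _ (is_cvg_series_exp_coeff x) 5%N); rewrite -/(expR x).
have incr : nondecreasing_seq (series (exp_coeff x)).
  by apply/nondecreasing_series => n _ _; apply: exp_coeff_ge0.
move=> /(_ incr); rewrite /series /= !big_nat_recr //= big_geq // /exp_coeff /=.
by rewrite add0r expr0 expr1 !divr1.
Qed.

Lemma ln2_ge : 13 / 20 <= ln 2 :> R.
Proof.
(* The tangent bound is too weak at -13/20 but, used at an eighth of it and raised to the eighth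
   power, exceeds 1/2. *)
have h : (1 - 13 / 160) ^+ 8 <= expR (- (13 / 20)) :> R.
  have -> : - (13 / 20) = 8%:R * - (13 / 160) :> R by lra.
  rewrite expRM_natl lerXn2r ?nnegrE ?expR_ge0 ?expR_ge1Dx //; lra.
rewrite -ler_expR lnK ?posrE ?ltr0n //.
have {}h : 2^-1 <= expR (- (13 / 20)) :> R.
  by apply: le_trans h; rewrite !exprS expr0; lra.
by move: h; rewrite expRN lef_pV2 ?posrE ?expR_gt0.
Qed.

(* From [t <= expR (t - 1)] at [t = l / 2]. *)
Lemma sqr_le_expR l : 0 <= l -> l ^+ 2 <= 16 / 25 * expR l.
Proof.
move=> l0; have h : 5 / 4 * l <= expR (l / 2).
  have := expR_ge1Dx (l / 2 - 1); rewrite expRB ler_pdivlMr ?expR_gt0 //.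
  have := expR_ge_taylor4 (@ler01 R); nra.
have -> : expR l = expR (l / 2) ^+ 2.
  by rewrite expr2 -expRD; congr expR; lra.
have := expR_ge0 (l / 2); nra.
Qed.

(** The best constant is 4 / e^2; 16/25 results from replacing e by 5/2. *)
Lemma sqr_ln_le x : 1 <= x -> ln x ^+ 2 <= 16 / 25 * x.
Proof.
move=> x1; have x0 : 0 < x by lra.
by have := sqr_le_expR (ln_ge0 x1); rewrite lnK.
Qed.

(** Follows from exp(y - z) >= 1 + y - z and (1 + z)(1 + y - z) = 1 + y + z(y - z). *)
Lemma expRN_1D_decreasing y z : 0 <= z -> z <= y ->
  expR (- y) * (1 + y) <= expR (- z) * (1 + z).
Proof.
move=> z0 zy; rewrite -[y](subrK z) opprD expRD mulrC mulrA.
rewrite [X in X <= _]mulrC ler_wpM2l ?expR_ge0 //.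
have := expR_ge1Dx (y - z); rewrite expRN => h.
rewrite ler_pdivrMr ?expR_gt0 //.
have := expR_gt0 (y - z); nra.
Qed.

(* The two summands are bounded separately: the first decreases with [x], and
   [ln x ^+ 2 / x] is largest at [ln x = 2]. *)
Lemma fraction_error_lt1 a c x : 7 / 4 <= a -> 83 / 100 <= c -> 2 <= x ->
  x `^ (- a) * (1 + a * ln x) + ln x ^+ 2 / (2 * c ^+ 2 * x) < 1.
Proof.
move=> a_ge c_ge x2; have x0 : 0 < x by lra.
have lx := @sqr_ln_le x; have l_ge : 13 / 20 <= ln x.
  by apply: le_trans ln2_ge _; rewrite ler_ln ?posrE ?ltr0n.
rewrite /powR gt_eqF // mulNr; set l := ln x in lx l_ge *.
have frac z e : 0 <= z -> z <= a * l -> 0 < e -> e <= expR z ->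
    expR (- (a * l)) * (1 + a * l) <= (1 + z) / e.
  move=> z0 zl e0 ez; apply: le_trans (expRN_1D_decreasing z0 zl) _.
  rewrite mulrC ler_wpM2l ?expRN ?lef_pV2 ?posrE ?expR_gt0 //; lra.
have {c_ge} c2 : 11 / 8 <= 2 * c ^+ 2 by nra.
have err q : l ^+ 2 <= q * x -> l ^+ 2 / (2 * c ^+ 2 * x) * (2 * c ^+ 2) <= q.
  have : 0 < 2 * c ^+ 2 by lra.
  move: (2 * c ^+ 2) => D D0 lq.
  by rewrite -ler_pdivlMr // ler_pdivrMr ?mulr_gt0 // mulrA divfK ?gt_eqF.
have err_ge0 : 0 <= l ^+ 2 / (2 * c ^+ 2 * x).
  by rewrite divr_ge0 ?sqr_ge0 // mulr_ge0 //; lra.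
move: err_ge0 err; set err := l ^+ 2 / _ => err_ge0 errP.
(* For l <= 1, x >= e l >= (5/2) l^2 improves 16/25 to 2/5, while a l >= (7/4)(13/20) >= 9/8 and
   exp(9/8) >= 3. For l >= 1, a l >= 7/4 and exp(7/4) >= 11/2 bound the first summand by 1/2. *)
have [l1|/ltW l1] := leP l 1.
  have : err * (2 * c ^+ 2) <= 2 / 5.
    apply: errP; have := expR_ge1Dx (l - 1).
    rewrite expRB ler_pdivlMr ?expR_gt0 // lnK //.
    have := expR_ge_taylor4 (@ler01 R); nra.
  have : expR (- (a * l)) * (1 + a * l) <= (1 + 9 / 8) / 3.
    apply: frac; [lra|nra|lra|].
    by apply: le_trans (@expR_ge_taylor4 (9 / 8) _); lra.
  nra.
have : err * (2 * c ^+ 2) <= 16 / 25 by apply/errP/lx; lra.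
have : expR (- (a * l)) * (1 + a * l) <= (1 + 7 / 4) / (11 / 2).
  apply: frac; [lra|nra|lra|].
  by apply: le_trans (@expR_ge_taylor4 (7 / 4) _); lra.
nra.
Qed.

(** Squaring c x <= k ln x bounds x / (2 k^2) by the second summand above; combined with (ln x)^2 <=
    16 x / 25 it also forces k > 1. *)
Lemma fraction_bound a c x k : 7 / 4 <= a -> 83 / 100 <= c -> 2 <= x -> 0 < k ->
  c * x / ln x <= k ->
  1 < k /\ x `^ (- a) * (1 + a * ln x) < 1 - x / (2 * k ^+ 2).
Proof.
move=> a_ge c_ge x2 k0; have lx := @sqr_ln_le x; have l0 : 0 < ln x.
  by apply: ln_gt0; lra.
have main := fraction_error_lt1 a_ge c_ge x2.
rewrite ler_pdivrMr // => kl; set l := ln x in lx l0 main kl *.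
have {}lx : l ^+ 2 <= 16 / 25 * x by apply: lx; lra.
have cx0 : 0 <= c * x by rewrite mulr_ge0; lra.
have sq : (c * x) ^+ 2 <= k ^+ 2 * l ^+ 2 by rewrite -exprMn lerXn2r ?nnegrE //; lra.
have k2 : c ^+ 2 * x <= 16 / 25 * k ^+ 2.
  have : c ^+ 2 * x * x <= 16 / 25 * k ^+ 2 * x.
    apply: (@le_trans _ _ (k ^+ 2 * l ^+ 2)); first by rewrite -mulrA -expr2 -exprMn.
    rewrite [leRHS](_ : _ = k ^+ 2 * (16 / 25 * x)); last by lra.
    by rewrite ler_wpM2l ?sqr_ge0.
  by rewrite ler_pM2r //; lra.
have c2 : 68 / 100 <= c ^+ 2 by nra.
split; first by have : 1 < k ^+ 2; nra.
suff : x / (2 * k ^+ 2) <= l ^+ 2 / (2 * c ^+ 2 * x) by lra.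
rewrite ler_pdivrMr ?mulr_gt0 ?exprn_gt0 // mulrAC ler_pdivlMr; last first.
  by rewrite !mulr_gt0 //; lra.
nra.
Qed.

End Estimates.

(** * The inequality over the reals and the list-color function *)

Lemma list_coloring_lower_bound (R : realType) (T : finType) (H : hypergraph T)
    (m r k : nat) (L : T -> {fset nat}) (a c : R) :
  linear_hypergraph H -> uniform H r -> #|edges H| = m ->
  (4 <= r)%N -> (3 <= m)%N -> (0 < k)%N -> 7 / 4 <= a -> 83 / 100 <= c ->
  c * (m%:R - 1) / ln (m%:R - 1) <= k%:R -> assignment k L -> (0 < alpha H k L)%N ->
  (m%:R - 1) `^ (- a) * (1 + a * ln (m%:R - 1)) * k%:R ^+ (#|T| - r)
    * (alpha H k L)%:R < (num_list_colorings H L)%:R - (num_colorings H k)%:R.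
Proof.
move=> lin unif mE r4 m3 k0 a_ge c_ge kbound assL.
have cardL v : #|` L v| = k by case: (assL v).
have x2 : 2 <= m%:R - 1 :> R by have : 3 <= m%:R :> R; [rewrite ler_nat | lra].
have k0R : 0 < k%:R :> R by rewrite ltr0n.
have [k1 frac] := fraction_bound a_ge c_ge x2 k0R kbound.
have := @deficit_lower_bound _ _ r (edges H) (ltn_trans _ r4) unif lin
  (initial_colors k L) (ord_list k L).
rewrite card_initial_colors mE -alphaE // -num_list_coloringsE -num_coloringsE.
move=> /(_ isT (card_ord_list cardL) r4 (ltnW m3)); rewrite -(ltr_nat R) => /(_ k1).
move=> + a0 => /(_ a0).
rewrite -(ler_nat R) !natrD !natrM !natrX -subn1 natrB ?(leq_trans _ m3) //.
rewrite -(ltr0n R) in a0; have N0 : 0 < (k%:R : R) ^+ (#|T| - r) by rewrite exprn_gt0.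
move: frac a0 N0; set x := m%:R - 1; set K := k%:R; set N := K ^+ (_ - _).
move: (_ `^ _ * _) => F; move: (alpha _ _ _)%:R => A.
move: (num_colorings _ _)%:R (num_list_colorings _ _)%:R => PK PL frac A0 N0 main.
have K2 : 0 < 2 * K ^+ 2 by rewrite mulr_gt0 // exprn_gt0.
(* The first comparison is the analytic estimate, the second the counting bound divided by 2 k^2. *)
apply: (@lt_le_trans _ _ ((1 - x / (2 * K ^+ 2)) * (N * A))).
  by rewrite -mulrA ltr_pM2r // mulr_gt0.
rewrite -(ler_pM2l K2) mulrA [_ * (1 - _)](_ : _ = 2 * K ^+ 2 - x).
  by move: main; rewrite /x; lra.
by rewrite mulrBr mulr1 [_ * (x / _)]mulrC divfK ?gt_eqF.
Qed.

Theorem theorem3 (R : realType) (T : finType) (H : hypergraph T) (n m r : nat)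
    (hlin : linear_hypergraph H) (hunif : uniform H r)
    (hn : #|T| = n) (hm : #|edges H| = m)
    (r_ge4 : (4 <= r)%N) (m_ge3 : (3 <= m)%N) :
  (forall (k : nat) (L : T -> {fset nat}),
     (0 < k)%N ->
     831 / 1000 * (m%:R - 1) / ln (m%:R - 1) <= k%:R :> R ->
     assignment k L ->
     (0 < alpha H k L)%N ->
     (num_list_colorings H L)%:R - (num_colorings H k)%:R >
       (m%:R - 1) `^ (- (1796 / 1000)) * (1 + 1796 / 1000 * ln (m%:R - 1))
         * k%:R ^+ (n - r) * (alpha H k L)%:R :> R) /\
  (forall k : nat,
     (0 < k)%N ->
     831 / 1000 * (m%:R - 1) / ln (m%:R - 1) <= k%:R :> R ->
     list_color_function H k = num_colorings H k).
Proof.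
have a_ge : 7 / 4 <= 1796 / 1000 :> R.
  exact: (@ler_nat_div R 7 4 1796 1000).
have c_ge : 83 / 100 <= 831 / 1000 :> R.
  exact: (@ler_nat_div R 83 100 831 1000).
have main := list_coloring_lower_bound hlin hunif hm r_ge4 m_ge3 _ a_ge c_ge.
split=> [k L k0 kbound assL alpha0|k k0 kbound].
  by rewrite -hn; apply: main.
have alpha_eq0 (L : T -> {fset nat}) : assignment k L -> alpha H k L = 0%N ->
    num_list_colorings H L = num_colorings H k.
  move=> assL; have cardL v : #|` L v| = k by case: (assL v).
  rewrite (@alphaE _ H k) // (num_list_coloringsE H k L) (num_coloringsE H k L).
  move=> alpha0; apply: good_eq_of_no_deficit alpha0 => [v|].
    by rewrite card_initial_colors card_ord_list.
  by rewrite card_initial_colors.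
apply/eqP; rewrite /list_color_function; case: ex_minnP => p pval pmin.
rewrite eqn_leq; apply/andP; split.
  (* The constant assignment [k] attains P(H, k), so the minimum is at most that. *)
  pose s := [fset x in iota 1 k]%fset.
  have sk : #|` s| = k by rewrite card_fseq undup_id ?iota_uniq // size_iota.
  have assS : assignment k (fun=> s).
    by split; last by rewrite !inE mem_iota.
  apply: pmin; apply/asboolP; exists (fun=> s) => //.
  by rewrite alpha_eq0 // alpha_const.
case/asboolP: pval => L assL ->.
(* For a minimizing [L] of positive deficit, the strict inequality suffices because its smaller side
   is nonnegative. *)
have [alpha0|alpha0] := posnP (alpha H k L); first by rewrite alpha_eq0.
rewrite -(ler_nat R) -subr_ge0; apply/ltW.
apply: le_lt_trans (main k L k0 kbound assL alpha0).
have a0 : 0 <= 1796 / 1000 :> R by apply: le_trans a_ge; rewrite divr_ge0 ?ler0n.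
have l0 : 0 <= ln (m%:R - 1 : R).
  by apply: ln_ge0; have : 3 <= m%:R :> R; [rewrite ler_nat | move=> ?; lra].
apply: mulr_ge0 _ (ler0n _ _); apply: mulr_ge0 _ (exprn_ge0 _ (ler0n _ _)).
exact: mulr_ge0 (powR_ge0 _ _) (addr_ge0 ler01 (mulr_ge0 a0 l0)).
Qed.
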